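(* Let $\{t_k\}_{k\in\mathbb N}$ be a sequence of positive relaxation parameters converging to zero. For each $k\in\mathbb N$, let $x_k\in X(\varphi^{t_k}_{\mathrm{FB}})$ be a KKT point of the nonlinear program (P$(\varphi^{t_k}_{\mathrm{FB}})$). Suppose that $\{x_k\}_{k\in\mathbb N}$ converges to some point $\bar x\in X$ where MPOC-MFCQ holds. Then $\bar x$ is a W-stationary point of (MPOC).
   Context: Let $n,m,p,q$ be positive integers, $\mathcal M:=\{1,\dots,m\}$, $\mathcal P:=\{1,\dots,p\}$, $\mathcal Q:=\{1,\dots,q\}$, and let $f,g_i,h_j,G_l,H_l\colon\mathbb R^n\to\mathbb R$ be continuously differentiable for all $i\in\mathcal M$, $j\in\mathcal P$, $l\in\mathcal Q$. The program (MPOC) is: minimize $f(x)$ subject to $g_i(x)\le 0$ ($i\in\mathcal M$), $h_j(x)=0$ ($j\in\mathcal P$), and ($G_l(x)\le 0$ or $H_l(x)\le 0$) for all $l\in\mathcal Q$. Its feasible set is $X$. For $t\ge0$ the smoothed Fischer--Burmeister function is $\varphi^t_{\mathrm{FB}}(a,b):=a+b-\sqrt{a^2+b^2+2t}$, $(a,b)\in\mathbb R^2$. The relaxed program (P$(\varphi^t_{\mathrm{FB}})$) is: minimize $f(x)$ subject to $g_i(x)\le 0$ ($i\in\mathcal M$), $h_j(x)=0$ ($j\in\mathcal P$), $\varphi^t_{\mathrm{FB}}(G_l(x),H_l(x))\le0$ ($l\in\mathcal Q$); its feasible set is $X(\varphi^t_{\mathrm{FB}})$. For $t>0$ it is a smooth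 nonlinear program. A feasible point $\bar x$ of a smooth nonlinear program $\min f$ s.t. $c_i\le 0$, $h_j=0$ is a KKT point if there are multipliers $\lambda_i\ge 0$ for the active inequality constraints ($c_i(\bar x)=0$) and $\rho_j\in\mathbb R$ with $0=\nabla f(\bar x)+\sum_{i:\,c_i(\bar x)=0}\lambda_i\nabla c_i(\bar x)+\sum_j\rho_j\nabla h_j(\bar x)$. For $\bar x\in X$ put $I^g(\bar x):=\{i\in\mathcal M: g_i(\bar x)=0\}$, $I^{0+}(\bar x):=\{l\in\mathcal Q: G_l(\bar x)=0,\ H_l(\bar x)>0\}$, $I^{+0}(\bar x):=\{l\in\mathcal Q: G_l(\bar x)>0,\ H_l(\bar x)=0\}$, $I^{00}(\bar x):=\{l\in\mathcal Q: G_l(\bar x)=0,\ H_l(\bar x)=0\}$. A union of families $\{v^i\}_{i=1}^r\cup\{w^j\}_{j=1}^s$ of vectors is positive-linearly independent if $\sum_i\alpha_iv^i+\sum_j\beta_jw^j=0$ with $\alpha_i\ge0$, $\beta_j\in\mathbb R$ forces all $\alpha_i,\beta_j$ to vanish. MPOC-MFCQ holds at $\bar x\in X$ if the family $$\bigl[\{\nabla g_i(\bar x)\}_{i\in I^g(\bar x)}\cup\{\nabla G_l(\bar x)\}_{l\in I^{0+}(\bar x)\cup I^{00}(\bar x)}\cup\{\nabla H_l(\bar x)\}_{l\in I^{+0}(\bar x)\cup I^{00}(\bar x)}\bigr]\cup\{\nabla h_j(\bar x)\}_{j\in\mathcal P}$$ is positive-linearly independent (bracketed vectors get nonnegative coefficients,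 the $\nabla h_j(\bar x)$ get free coefficients). A point $\bar x\in X$ is W-stationary for (MPOC) if there are multipliers $\lambda_i\ge0$ ($i\in I^g(\bar x)$), $\rho_j\in\mathbb R$ ($j\in\mathcal P$), $\mu_l\ge 0$ ($l\in I^{0+}(\bar x)\cup I^{00}(\bar x)$), $\nu_l\ge0$ ($l\in I^{+0}(\bar x)\cup I^{00}(\bar x)$) with $$0=\nabla f(\bar x)+\sum_{i\in I^g(\bar x)}\lambda_i\nabla g_i(\bar x)+\sum_{j\in\mathcal P}\rho_j\nabla h_j(\bar x)+\sum_{l\in I^{0+}(\bar x)\cup I^{00}(\bar x)}\mu_l\nabla G_l(\bar x)+\sum_{l\in I^{+0}(\bar x)\cup I^{00}(\bar x)}\nu_l\nabla H_l(\bar x).$$ *)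

(* Defs.v *)
From HB Require Import structures.
From mathcomp Require Import all_boot all_order all_algebra.
From mathcomp Require Import all_classical all_reals all_analysis.
Set Implicit Arguments.
Unset Strict Implicit.
Unset Printing Implicit Defensive.
Import Order.TTheory GRing.Theory Num.Theory.
Import numFieldNormedType.Exports.
Local Open Scope classical_set_scope.
Local Open Scope ring_scope.

Section Gradient.
Context {R : realType} {n : nat}.
Implicit Type F : 'rV[R]_n -> R.

Definition grad F (x : 'rV[R]_n) : 'rV[R]_n :=
  \row_(i < n) 'D_(delta_mx 0 i) F x.

Definition C1 F : Prop :=
  (forall x, differentiable F x) /\ continuous (grad F).

End Gradient.

(* The vectors [v i], [i \in A], get nonnegative coefficients and the [w j]
   get free ones.  Families are indexed, so repeated vectors count as
   dependent; coefficients outside [A] are irrelevant. *)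
Definition pos_lin_indep {R : realType} {V : lmodType R} {I J : finType}
    (A : {set I}) (v : I -> V) (w : J -> V) : Prop :=
  forall (alpha : I -> R) (beta : J -> R),
    (forall i, i \in A -> 0 <= alpha i) ->
    \sum_(i in A) alpha i *: v i + \sum_j beta j *: w j = 0 ->
    (forall i, i \in A -> alpha i = 0) /\ (forall j, beta j = 0).

(* The nonlinear program: minimize [f] subject to [c i <= 0] and [h j = 0]. *)
Section NonlinearProgram.
Context {R : realType} {n : nat} {I J : finType}.
Variables (f : 'rV[R]_n -> R).
Variables (c : I -> 'rV[R]_n -> R) (h : J -> 'rV[R]_n -> R).

Definition nlp_feasible : set 'rV[R]_n :=
  [set x | (forall i, c i x <= 0) /\ (forall j, h j x = 0)].

Definition KKT_point (x : 'rV[R]_n) : Prop :=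
  nlp_feasible x /\
  exists (lambda : I -> R) (rho : J -> R),
    (forall i, c i x = 0 -> 0 <= lambda i) /\
    0 = grad f x + \sum_(i | c i x == 0) lambda i *: grad (c i) x
        + \sum_j rho j *: grad (h j) x.

End NonlinearProgram.

Section MPOC.
Context {R : realType} {n m p q : nat}.
Variables (f : 'rV[R]_n -> R) (g : 'I_m -> 'rV[R]_n -> R).
Variables (h : 'I_p -> 'rV[R]_n -> R) (G H : 'I_q -> 'rV[R]_n -> R).

Definition mpoc_feasible : set 'rV[R]_n :=
  [set x | [/\ forall i, g i x <= 0,
               forall j, h j x = 0
             & forall l, G l x <= 0 \/ H l x <= 0]].

Definition Ig (x : 'rV[R]_n) : {set 'I_m} := [set i | g i x == 0]%SET.
Definition I0p (x : 'rV[R]_n) : {set 'I_q} :=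
  [set l | (G l x == 0) && (0 < H l x)]%SET.
Definition Ip0 (x : 'rV[R]_n) : {set 'I_q} :=
  [set l | (0 < G l x) && (H l x == 0)]%SET.
Definition I00 (x : 'rV[R]_n) : {set 'I_q} :=
  [set l | (G l x == 0) && (H l x == 0)]%SET.

(* The bracketed family is indexed by the disjoint union of the index sets of
   the gradients of [g], [G] and [H], in this order. *)
Definition mfcq_index (x : 'rV[R]_n) : {set 'I_m + 'I_q + 'I_q} :=
  [set s | match s with
           | inl (inl i) => i \in Ig x
           | inl (inr l) => l \in I0p x :|: I00 x
           | inr l => l \in Ip0 x :|: I00 x
           end]%SET.

Definition mfcq_family (x : 'rV[R]_n) (s : 'I_m + 'I_q + 'I_q) : 'rV[R]_n :=
  match s with
  | inl (inl i) => grad (g i) x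
  | inl (inr l) => grad (G l) x
  | inr l => grad (H l) x
  end.

Definition MPOC_MFCQ (x : 'rV[R]_n) : Prop :=
  pos_lin_indep (mfcq_index x) (mfcq_family x) (fun j => grad (h j) x).

Definition W_stationary (x : 'rV[R]_n) : Prop :=
  mpoc_feasible x /\
  exists (lambda : 'I_m -> R) (rho : 'I_p -> R) (mu nu : 'I_q -> R),
    [/\ forall i, i \in Ig x -> 0 <= lambda i,
        forall l, l \in I0p x :|: I00 x -> 0 <= mu l,
        forall l, l \in Ip0 x :|: I00 x -> 0 <= nu l
      & 0 = grad f x
            + \sum_(i in Ig x) lambda i *: grad (g i) x
            + \sum_j rho j *: grad (h j) x
            + \sum_(l in I0p x :|: I00 x) mu l *: grad (G l) x
            + \sum_(l in Ip0 x :|: I00 x) nu l *: grad (H l) x].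

Definition phi_FB (t a b : R) : R :=
  a + b - Num.sqrt (a ^+ 2 + b ^+ 2 + 2 * t).

Definition FB_constraint (t : R) (s : 'I_m + 'I_q) : 'rV[R]_n -> R :=
  match s with
  | inl i => g i
  | inr l => fun x => phi_FB t (G l x) (H l x)
  end.

Definition X_FB (t : R) : set 'rV[R]_n := nlp_feasible (FB_constraint t) h.

Definition FB_KKT_point (t : R) (x : 'rV[R]_n) : Prop :=
  KKT_point f (FB_constraint t) h x.

End MPOC.

(* Main.v *)
Require Import Defs.
From mathcomp Require Import all_boot all_order all_algebra.
From mathcomp Require Import all_classical all_reals all_analysis.
From mathcomp Require Import ring lra.
Import Order.TTheory GRing.Theory Num.Theory.
Import numFieldNormedType.Exports.
Local Open Scope classical_set_scope.
Local Open Scope ring_scope.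
Set Implicit Arguments.
Unset Strict Implicit.
Unset Printing Implicit Defensive.

(** Call a point a Fritz John point if the stationarity equation of the
disjunctive program holds there with a multiplier [sigma >= 0] in front of the
objective gradient, with all multipliers normalized to total mass [1].

An active constraint [phi_FB t (G l) (H l) = 0] with [t > 0] means that [G l]
and [H l] are positive with product [t], and its gradient is then the convex
combination of the gradients of [G l] and [H l] with weights
[H l / (G l + H l)] and [G l / (G l + H l)] ([grad_phi_FB]).  Distributing the
KKT multiplier of this constraint according to these weights and dividing by
the total mass turns every KKT point of the relaxed program into a Fritz John
point ([FB_KKT_fritz_john]).  How the multipliers [mu l], [nu l] of [G l],
[H l] depend on the weights is remembered only through relations in which the
parameter [t] does not occur:
[mu l * G l = nu l * H l], and all of [mu l * G l], [mu l * H l],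
[nu l * G l], [nu l * H l] are nonnegative.

All these conditions are closed, and normalized multipliers are bounded, so
they pass to the limit along an ultrafilter finer than the filter of cofinite
sets; the limit of the points [x k] is again a Fritz John point
([fritz_john_limit]).  At a point feasible for the disjunctive program the
limiting relations force the multipliers to vanish off the index sets of
W-stationarity ([fritz_john_support]).  If [sigma] were zero, MPOC-MFCQ would
make all multipliers zero, against the normalization; so [sigma > 0], and
dividing by it gives W-stationarity ([fritz_john_W_stationary]).

Normalizing before passing to the limit treats bounded and unbounded sequences
of KKT multipliers at once, and the ultrafilter replaces the successive
extraction of subsequences, one for each multiplier. *)

(** * Limits along ultrafilters *)

(** By compactness the image of [U] has a cluster point; an ultrafilter
converges to each of its cluster points, since it contains the preimage of any
neighbourhood or the complement of that preimage. *)
Lemma bounded_cvg_ultra {R : realType} {T : Type} {U : set_system T}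
    (UU : UltraFilter U) {a : T -> R} {B : R} :
  (forall k, `|a k| <= B) -> exists l : R, a k @[k --> U] --> l.
Proof.
move=> aB; have UP := @ultra_proper _ _ UU.
have [|l [_ al]] := @segment_compact _ (- B) B (fmap a U) _ _.
  by apply: (@filterE _ U) => k; rewrite /= in_itv /= -ler_norml.
exists l => V lV; have [//|aVC] := in_ultra_setVsetC (a @^-1` V) UU.
by have [r [+ Vr]] := al (~` V) V aVC lV => /(_ Vr).
Qed.

(** * The smoothed Fischer-Burmeister function *)

(** Squaring [a + b = sqrt (a ^+ 2 + b ^+ 2 + 2 * t)] gives [a * b = t > 0],
and the right-hand side of the equation is positive. *)
Lemma phi_FB_eq0 {R : realType} {t a b : R} : 0 < t -> phi_FB t a b = 0 ->
  [/\ 0 < a, 0 < b & Num.sqrt (a ^+ 2 + b ^+ 2 + 2 * t) = a + b].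
Proof.
move=> t0 /eqP; rewrite subr_eq0 eq_sym => /eqP ab.
have s0 : 0 < a ^+ 2 + b ^+ 2 + 2 * t by nra.
have ab0 : 0 < a + b by rewrite -ab sqrtr_gt0.
have := sqr_sqrtr (ltW s0); rewrite ab => sq; have abt : a * b = t by nra.
by split => //; nra.
Qed.

Section Gradients.
Context {R : realType} {n : nat}.
Implicit Types (F a b : 'rV[R]_n -> R) (x v : 'rV[R]_n).

Lemma is_derive_sqrt_comp F x v : differentiable F x -> 0 < F x ->
  is_derive x v (fun y => Num.sqrt (F y)) ((2 * Num.sqrt (F x))^-1 * 'D_v F x).
Proof.
move=> dF F0; have dS := is_derive1_sqrt F0.
have dsqrt : differentiable (@Num.sqrt R) (F x).
  by apply/derivable1_diffP; exact: ex_derive.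
have dSF : differentiable (Num.sqrt \o F) x by exact: differentiable_comp.
split; first exact: diff_derivable.
rewrite deriveE // diff_comp //= diff1E // derive1E derive_val -deriveE //.
exact: mulrC.
Qed.

(** The chain rule gives the coefficient [1 - a / sqrt (a^2 + b^2 + 2 t)] for
[grad a]; at a zero of [phi_FB t] the root equals [a + b], so this is
[b / (a + b)]. *)
Lemma grad_phi_FB t a b x : 0 < t -> differentiable a x -> differentiable b x ->
  phi_FB t (a x) (b x) = 0 ->
  grad (fun y => phi_FB t (a y) (b y)) x =
  (b x / (a x + b x)) *: grad a x + (a x / (a x + b x)) *: grad b x.
Proof.
move=> t0 da db /(phi_FB_eq0 t0)[a0 b0 ab].
apply/rowP => i; rewrite !mxE; set v := delta_mx 0 i.
have Da : is_derive x v a ('D_v a x) by split => //; exact: diff_derivable.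
have Db : is_derive x v b ('D_v b x) by split => //; exact: diff_derivable.
have s0 : 0 < a x ^+ 2 + b x ^+ 2 + 2 * t by nra.
pose F := a ^+ 2 + b ^+ 2 + cst (2 * t).
have dF : differentiable F x.
  exact: differentiableD (differentiableD (differentiableX 1 da)
    (differentiableX 1 db)) (differentiable_cst (2 * t) x).
have DF : is_derive x v F _ := is_deriveD
  (is_deriveD (is_deriveX 2 Da) (is_deriveX 2 Db)) (is_derive_cst (2 * t) x v).
have Ds := @is_derive_sqrt_comp F x v dF s0.
have -> : (fun y => phi_FB t (a y) (b y)) = a + b - (fun y => Num.sqrt (F y)).
  by [].
rewrite derive_val (@derive_val _ _ _ _ _ _ _ DF).
have -> : F x = a x ^+ 2 + b x ^+ 2 + 2 * t by [].
rewrite ab /= !expr1 /GRing.scale /=.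
by field; rewrite gt_eqF // addr_gt0.
Qed.

End Gradients.

(** * Fritz John points of the disjunctive program *)

Section FritzJohn.
Context {R : realType} {n m p q : nat}.
Variables (f : 'rV[R]_n -> R) (g : 'I_m -> 'rV[R]_n -> R).
Variables (h : 'I_p -> 'rV[R]_n -> R) (G H : 'I_q -> 'rV[R]_n -> R).

Definition lagrangian_grad (x : 'rV[R]_n) (sigma : R)
    (alpha : 'I_m + 'I_q + 'I_q -> R) (beta : 'I_p -> R) : 'rV[R]_n :=
  sigma *: grad f x + \sum_s alpha s *: mfcq_family g G H x s
  + \sum_j beta j *: grad (h j) x.

(** The coefficients [alpha] share the index type of [mfcq_family], so that
they can be fed to MPOC-MFCQ directly: [alpha (inl (inl i))] belongs to [g i],
[alpha (inl (inr l))], called mu, to [G l], and [alpha (inr l)], called nu, to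
[H l].  The sums range over all indices, and inactivity is expressed by
equations and non-strict inequalities between products, because these survive
limits whereas the active index sets do not. *)
Record fritz_john (x : 'rV[R]_n) (sigma : R)
    (alpha : 'I_m + 'I_q + 'I_q -> R) (beta : 'I_p -> R) : Prop := FritzJohn {
  fj_sigma_ge0 : 0 <= sigma;
  fj_alpha_ge0 : forall s, 0 <= alpha s;
  fj_norm1 : sigma + \sum_s alpha s + \sum_j `|beta j| = 1;
  fj_stationary : lagrangian_grad x sigma alpha beta = 0;
  fj_compl_g : forall i, alpha (inl (inl i)) * g i x = 0;
  fj_muG : forall l, 0 <= alpha (inl (inr l)) * G l x;
  fj_muH : forall l, 0 <= alpha (inl (inr l)) * H l x;
  fj_nuG : forall l, 0 <= alpha (inr l) * G l x;
  fj_nuH : forall l, 0 <= alpha (inr l) * H l x;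
  fj_balance : forall l, alpha (inl (inr l)) * G l x = alpha (inr l) * H l x
}.

Lemma fritz_john_le1 x sigma alpha beta : fritz_john x sigma alpha beta ->
  [/\ `|sigma| <= 1, forall s, `|alpha s| <= 1 & forall j, `|beta j| <= 1].
Proof.
case=> s0 a0 N1 _ _ _ _ _ _ _.
have A0 : 0 <= \sum_s alpha s by exact: sumr_ge0.
have B0 : 0 <= \sum_j `|beta j| by exact: sumr_ge0.
split=> [|s|j]; first by rewrite ger0_norm //; lra.
- rewrite ger0_norm //; have : alpha s <= \sum_s alpha s; last by lra.
  by rewrite (bigD1 s) //= lerDl sumr_ge0.
- have : `|beta j| <= \sum_j `|beta j|; last by lra.
  by rewrite (bigD1 j) //= lerDl sumr_ge0.
Qed.

(** If [lam] is the KKT multiplier of the [l]-th relaxed constraint, take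
[mu = lam * H / (G + H)] and [nu = lam * G / (G + H)], up to normalization;
then [mu * G = nu * H], and for active [l] all quantities involved are
nonnegative. *)
Lemma FB_KKT_fritz_john t x : 0 < t ->
  (forall l, differentiable (G l) x) -> (forall l, differentiable (H l) x) ->
  FB_KKT_point f g h G H t x ->
  exists sigma alpha beta, fritz_john x sigma alpha beta.
Proof.
move=> t0 dG dH [_ [lam [rho [lam0 stat]]]].
pose c := FB_constraint g G H t.
(* The multipliers of inactive constraints are arbitrary; zero them out. *)
pose lam' s := if c s x == 0 then lam s else 0.
have lam'0 s : 0 <= lam' s by rewrite /lam'; case: eqP => // /lam0.
pose w (s : 'I_m + 'I_q + 'I_q) := match s with
  | inl (inl i) => lam' (inl i)
  | inl (inr l) => lam' (inr l) * (H l x / (G l x + H l x))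
  | inr l => lam' (inr l) * (G l x / (G l x + H l x)) end.
have active l : lam' (inr l) = 0 \/ [/\ 0 < G l x, 0 < H l x &
    phi_FB t (G l x) (H l x) = 0].
  rewrite /lam'; case: eqP => [cl|_]; [right|by left].
  by have [] := phi_FB_eq0 t0 cl.
have w0 s : 0 <= w s.
  case: s => [[i|l]|l] //=; case: (active l) => [->|[Gl Hl _]];
    rewrite ?mul0r // mulr_ge0 // divr_ge0 ?addr_ge0 ?ltW //.
(* The summand [1] is the multiplier of the objective gradient. *)
pose N := 1 + \sum_s w s + \sum_j `|rho j|.
have N0 : 0 < N by rewrite !ltr_wpDr ?ltr01 ?sumr_ge0.
have stat_w : lagrangian_grad x 1 w rho = 0.
  rewrite [RHS]stat /lagrangian_grad scale1r; congr (_ + _ + _).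
  rewrite [RHS]big_mkcond /=.
  rewrite (eq_bigr (fun s => lam' s *: grad (c s) x)); last first.
    by move=> s _; rewrite /lam'; case: ifP => //; rewrite scale0r.
  rewrite !big_sumType /= -addrA; congr (_ + _).
  rewrite -big_split /=; apply: eq_bigr => l _.
  case: (active l) => [->|[_ _ cl]]; first by rewrite !mul0r !scale0r addr0.
  by rewrite grad_phi_FB // scalerDr !scalerA.
exists N^-1, (fun s => N^-1 * w s), (fun j => N^-1 * rho j).
have N0' : 0 <= N^-1 by rewrite invr_ge0 ltW.
have w_sign l : [/\ 0 <= w (inl (inr l)) * G l x, 0 <= w (inl (inr l)) * H l x,
    0 <= w (inr l) * G l x & 0 <= w (inr l) * H l x].
  rewrite /w; case: (active l) => [->|[Gl Hl _]]; first by rewrite !mul0r.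
  by split; rewrite !mulr_ge0 ?lam'0 ?invr_ge0 ?addr_ge0 ?ltW.
split => //.
- by move=> s; rewrite mulr_ge0.
- rewrite -mulr_sumr.
  under [X in _ + X]eq_bigr do rewrite normrM (ger0_norm N0').
  by have := mulVf (lt0r_neq0 N0); rewrite -mulr_sumr {2}/N !mulrDr mulr1.
- transitivity (N^-1 *: lagrangian_grad x 1 w rho); last first.
    by rewrite stat_w scaler0.
  rewrite /lagrangian_grad !scalerDr !scaler_sumr scale1r.
  by congr (_ + _ + _); apply: eq_bigr => s _; rewrite scalerA.
- move=> i; rewrite /= /lam'; case: eqP => [gi|_]; last by rewrite mulr0 mul0r.
  by rewrite [g i x]gi mulr0.
- by move=> l; have [? _ _ _] := w_sign l; rewrite -mulrA mulr_ge0.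
- by move=> l; have [_ ? _ _] := w_sign l; rewrite -mulrA mulr_ge0.
- by move=> l; have [_ _ ? _] := w_sign l; rewrite -mulrA mulr_ge0.
- by move=> l; have [_ _ _ ?] := w_sign l; rewrite -mulrA mulr_ge0.
- by move=> l /=; ring.
Qed.

(** The normalization keeps all multipliers in [[-1, 1]], so along an
ultrafilter each of them converges, and so do the gradients, which are
continuous; every field of [fritz_john] is a closed condition.  No
multiplier is lost in the limit because the total mass stays [1]. *)
Lemma fritz_john_limit (x : nat -> 'rV[R]_n) (xbar : 'rV[R]_n) :
  C1 f -> (forall i, C1 (g i)) -> (forall j, C1 (h j)) ->
  (forall l, C1 (G l)) -> (forall l, C1 (H l)) ->
  x k @[k --> \oo] --> xbar ->
  (forall k, exists sigma alpha beta, fritz_john (x k) sigma alpha beta) ->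
  exists sigma alpha beta, fritz_john xbar sigma alpha beta.
Proof.
move=> fC gC hC GC HC x_cvg /choice[sigma /choice[alpha /choice[beta fj]]].
have [U [UU leU]] := ultraFilterLemma (F := \oo) _.
have UP := @ultra_proper _ _ UU.
have xU : x k @[k --> U] --> xbar by apply: cvg_trans x_cvg; exact: cvg_app leU.
have evalU F : C1 F -> F (x k) @[k --> U] --> F xbar.
  move=> [dF _]; apply: cvg_comp xU _.
  exact: differentiable_continuous (dF xbar).
have gradU F : C1 F -> grad F (x k) @[k --> U] --> grad F xbar.
  by move=> [_ cF]; apply: cvg_comp xU _; exact: cF.
have [sigma' sigmaU] : exists l : R, sigma k @[k --> U] --> l.
  apply: (bounded_cvg_ultra UU (B := 1)) => k.
  by have [] := fritz_john_le1 (fj k).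
have /choice[alpha' alphaU] s : exists l : R, alpha k s @[k --> U] --> l.
  apply: (bounded_cvg_ultra UU (B := 1)) => k.
  by have [] := fritz_john_le1 (fj k).
have /choice[beta' betaU] j : exists l : R, beta k j @[k --> U] --> l.
  apply: (bounded_cvg_ultra UU (B := 1)) => k.
  by have [] := fritz_john_le1 (fj k).
exists sigma', alpha', beta'.
have ge0U (u : nat -> R) l :
    (forall k, 0 <= u k) -> u k @[k --> U] --> l -> 0 <= l.
  move=> u0 ul; apply: (@closed_cvg _ _ U _ u [set y : R | 0 <= y] _ _ l ul).
    exact: closed_ge.
  exact: (@filterE _ U).
have constU (V : normedModType R) (u : nat -> V) (c l : V) :
    u k @[k --> U] --> l -> (forall k, u k = c) -> l = c.
  move=> ul uc; have cu : u k @[k --> U] --> c.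
    by have -> : u = cst c; [exact/funext | exact: cvg_cst].
  exact: (@cvg_unique _ (@norm_hausdorff _ V) (fmap u U) _ _ _ ul cu).
have prodU s F : C1 F ->
    alpha k s * F (x k) @[k --> U] --> alpha' s * F xbar.
  by move=> /evalU; exact: cvgM (alphaU s).
have famU s : mfcq_family g G H (x k) s @[k --> U] --> mfcq_family g G H xbar s.
  case: s => [[i|l]|l].
  - exact: gradU (gC i).
  - exact: gradU (GC l).
  - exact: gradU (HC l).
split.
- by apply: ge0U sigmaU => k; exact: fj_sigma_ge0 (fj k).
- by move=> s; apply: ge0U (alphaU s) => k; exact: (fj_alpha_ge0 (fj k) s).
- have lim : sigma k + \sum_s alpha k s + \sum_j `|beta k j| @[k --> U] -->
      sigma' + \sum_s alpha' s + \sum_j `|beta' j|.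
    apply: cvgD; first apply: cvgD => //.
      by apply: cvg_big => [|s _]; [exact: add_continuous|exact: alphaU].
    apply: cvg_big => [|j _]; first exact: add_continuous.
    exact: cvg_norm (betaU j).
  exact: (constU R _ _ _ lim (fun k => fj_norm1 (fj k))).
- have lim : lagrangian_grad (x k) (sigma k) (alpha k) (beta k) @[k --> U] -->
      lagrangian_grad xbar sigma' alpha' beta'.
    apply: cvgD; first apply: cvgD.
    + exact: cvgZ sigmaU (gradU _ fC).
    + by apply: cvg_big => [|s _]; [exact: add_continuous|exact: cvgZ].
    + apply: cvg_big => [|j _]; first exact: add_continuous.
      exact: cvgZ (betaU j) (gradU _ (hC j)).
  exact: (constU _ _ _ _ lim (fun k => fj_stationary (fj k))).
- move=> i; have lim := prodU (inl (inl i)) _ (gC i).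
  exact: (constU R _ _ _ lim (fun k => fj_compl_g (fj k) i)).
- move=> l; apply: ge0U (prodU _ _ (GC l)) => k.
  exact: fj_muG (fj k) l.
- move=> l; apply: ge0U (prodU _ _ (HC l)) => k.
  exact: fj_muH (fj k) l.
- move=> l; apply: ge0U (prodU _ _ (GC l)) => k.
  exact: fj_nuG (fj k) l.
- move=> l; apply: ge0U (prodU _ _ (HC l)) => k.
  exact: fj_nuH (fj k) l.
- move=> l; have limG := prodU (inl (inr l)) _ (GC l).
  have limH := prodU (inr l) _ (HC l).
  apply/subr0_eq; apply: (constU R _ _ _ (cvgB limG limH)) => k.
  by rewrite /= (fj_balance (fj k)) subrr.
Qed.

(** Let [mu > 0] be the multiplier of [G l].  The sign conditions yield
[G l >= 0] and [H l >= 0], so it remains to see that [G l = 0]: by feasibility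
[G l <= 0] or [H l <= 0], and in the second case [H l = 0], whence
[mu * G l = nu * H l = 0].  The roles of [G] and [H] are symmetric. *)
Lemma fritz_john_support x sigma alpha beta : mpoc_feasible g h G H x ->
  fritz_john x sigma alpha beta ->
  forall s, s \notin mfcq_index g G H x -> alpha s = 0.
Proof.
move=> [_ _ xGH] [_ a0 _ _ cg muG muH nuG nuH bal] [[i|l]|l]; rewrite inE.
- rewrite inE => gi; have /eqP := cg i.
  by rewrite mulf_eq0 (negbTE gi) orbF => /eqP.
- rewrite !inE => lN; apply/eqP; rewrite eq_le a0 andbT leNgt.
  apply/negP => mu0.
  have := muG l; have := muH l; rewrite !pmulr_rge0 // => H0 G0.
  suff G00 : G l x = 0.
    by move: lN; rewrite G00 eqxx lt_neqAle H0 eq_sym andbT; case: eqP.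
  case: (xGH l) => [?|Hle]; first lra.
  have Hl : H l x = 0 by lra.
  by have /eqP := bal l; rewrite Hl mulr0 mulf_eq0 gt_eqF //= => /eqP.
- rewrite !inE => lN; apply/eqP; rewrite eq_le a0 andbT leNgt.
  apply/negP => nu0.
  have := nuG l; have := nuH l; rewrite !pmulr_rge0 // => H0 G0.
  suff H00 : H l x = 0.
    by move: lN; rewrite H00 eqxx lt_neqAle G0 eq_sym !andbT; case: eqP.
  case: (xGH l) => [Gle|?]; last lra.
  have Gl : G l x = 0 by lra.
  by have /eqP := bal l; rewrite Gl mulr0 eq_sym mulf_eq0 gt_eqF //= => /eqP.
Qed.

(** MPOC-MFCQ excludes the degenerate multiplier [sigma = 0]: it would make
all the other multipliers vanish, which contradicts their total mass [1]. *)
Lemma fritz_john_W_stationary x sigma alpha beta : mpoc_feasible g h G H x ->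
  MPOC_MFCQ g h G H x -> fritz_john x sigma alpha beta ->
  W_stationary f g h G H x.
Proof.
move=> xX mfcq fj; have supp := fritz_john_support xX fj.
case: fj => s0 a0 N1 stat _ _ _ _ _ _.
move: stat; rewrite /lagrangian_grad.
have -> : \sum_s alpha s *: mfcq_family g G H x s =
    \sum_(s in mfcq_index g G H x) alpha s *: mfcq_family g G H x s.
  rewrite [RHS]big_mkcond /=; apply: eq_bigr => s _.
  by case: ifPn => // /supp ->; rewrite scale0r.
move=> stat'.
have sigma_gt0 : 0 < sigma.
  rewrite lt_neqAle s0 andbT; apply/eqP => s00.
  move: stat' N1; rewrite -s00 scale0r !add0r => /mfcq[//|aA b0].
  rewrite !big1 ?addr0 => [/esym/eqP||s _]; first by rewrite oner_eq0.
  - by move=> j _; rewrite b0 normr0.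
  - by have [/aA //|/supp] := boolP (s \in mfcq_index g G H x).
have i0 : 0 <= sigma^-1 by rewrite invr_ge0 ltW.
split => //.
exists (fun i => sigma^-1 * alpha (inl (inl i))), (fun j => sigma^-1 * beta j),
  (fun l => sigma^-1 * alpha (inl (inr l))),
  (fun l => sigma^-1 * alpha (inr l)).
split; try by move=> l _; exact: mulr_ge0.
rewrite -[LHS](scaler0 _ sigma^-1) -[in LHS]stat' !scalerDr scalerA.
rewrite mulVf ?gt_eqF //.
rewrite scale1r !big_sumType /= !scalerDr !scaler_sumr.
rewrite !addrA [LHS]addrAC; congr (_ + _); last first.
  by apply: eq_big => [l|l _]; rewrite ?scalerA // inE.
rewrite [LHS]addrAC; congr (_ + _ + _ + _).
- by apply: eq_big => [i|i _]; rewrite ?scalerA // inE.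
- by apply: eq_bigr => j _; rewrite scalerA.
- by apply: eq_big => [l|l _]; rewrite ?scalerA // inE.
Qed.

End FritzJohn.

Unset Implicit Arguments.
Set Strict Implicit.

Theorem theorem5p2 (R : realType) (n m p q : nat)
    (n_gt0 : (0 < n)%N) (m_gt0 : (0 < m)%N)
    (p_gt0 : (0 < p)%N) (q_gt0 : (0 < q)%N)
    (f : 'rV[R]_n -> R) (g : 'I_m -> 'rV[R]_n -> R)
    (h : 'I_p -> 'rV[R]_n -> R) (G H : 'I_q -> 'rV[R]_n -> R)
    (f_C1 : C1 f) (g_C1 : forall i, C1 (g i)) (h_C1 : forall j, C1 (h j))
    (G_C1 : forall l, C1 (G l)) (H_C1 : forall l, C1 (H l))
    (t : nat -> R) (t_gt0 : forall k, 0 < t k) (t_cvg : t k @[k --> \oo] --> 0)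
    (x : nat -> 'rV[R]_n) (xbar : 'rV[R]_n)
    (x_feas : forall k, X_FB g h G H (t k) (x k))
    (x_KKT : forall k, FB_KKT_point f g h G H (t k) (x k))
    (x_cvg : x k @[k --> \oo] --> xbar)
    (xbar_feas : mpoc_feasible g h G H xbar)
    (xbar_MFCQ : MPOC_MFCQ g h G H xbar) :
  W_stationary f g h G H xbar.
Proof.
have x_FJ k : exists sigma alpha beta,
    fritz_john f g h G H (x k) sigma alpha beta.
  apply: (FB_KKT_fritz_john (t_gt0 k) _ _ (x_KKT k)) => l.
    by have [] := G_C1 l.
  by have [] := H_C1 l.
have [sigma [alpha [beta xbar_FJ]]] :=
  fritz_john_limit f_C1 g_C1 h_C1 G_C1 H_C1 x_cvg x_FJ.
exact: fritz_john_W_stationary xbar_feas xbar_MFCQ xbar_FJ.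
Qed.
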